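(* There is an absolute constant $c>0$ such that the following holds. Let $(X,E)$ be a finite connected undirected graph without loops, with at least two vertices, let $m$ be the shortest path metric on $X$, let $\mu$ be the stationary distribution of the simple nearest neighbour random walk on $(X,E)$, and let $\lambda_1\le\lambda_2\le\dots\le\lambda_{|X|-1}$ be the non-zero eigenvalues, listed with multiplicity in non-decreasing order, of the Laplacian $\Delta$ of $(X,E)$. Let $n>1$ be an integer for which the index $\lfloor n/2\rfloor-1$ lies in $\{1,\dots,|X|-1\}$, and let $T:X\to\mathbb{R}^n$ be a map with Lipschitz constant at most $1$, i.e. $|T(x)-T(y)|\le m(x,y)$ for all $x,y\in X$. Then there is $\theta\in S^{n-1}$ such that $$\|\theta\|_{L_2}\;\le\; c\, n^{-1/2}\,\lambda_{\lfloor n/2\rfloor-1}^{-1/2},\qquad\text{where}\quad \|\theta\|_{L_2}=\left(\int_X \langle T(x),\theta\rangle^2\,d\mu(x)\right)^{1/2}.$$ The constant $c$ does not depend on $(X,E)$, $n$ or $T$.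
   Context: $\mathbb{R}^n$ carries the standard inner product $\langle\cdot,\cdot\rangle$ and the Euclidean norm $|\cdot|$; $S^{n-1}$ is its unit sphere. For a finite connected undirected graph $(X,E)$ without loops ($E$ is a set of edges, so there are no multiple edges), write $x\sim y$ if $x,y$ are joined by an edge, let $d(x)$ be the degree of $x$ and $|E|$ the number of undirected edges. The stationary distribution is the probability measure $\mu(x)=\frac{d(x)}{2|E|}$ on $X$. The Laplacian acts on real-valued functions $f:X\to\mathbb{R}$ by $$\Delta(f)(x)=2\left(f(x)-\frac{1}{d(x)}\sum_{y\sim x}f(y)\right).$$ It is self-adjoint and non-negative with respect to the inner product $[f,g]_X=\int_X f g\,d\mu$, and its kernel is the one-dimensional space of constant functions, so it has exactly $|X|-1$ non-zero eigenvalues counted with multiplicity, all positive. *)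

(* Defs.v *)
From HB Require Import structures.
From mathcomp Require Export all_boot all_order all_algebra.
From mathcomp Require Export reals.
From mathcomp Require Import ring.

Set Implicit Arguments.
Unset Strict Implicit.
Unset Printing Implicit Defensive.

Import Order.TTheory GRing.Theory Num.Theory.

Local Open Scope ring_scope.

Section Graph.
Variables (X : finType) (e : rel X).

Definition degree (x : X) : nat := #|[set y | e x y]|.

(* An undirected edge is the unordered pair of its endpoints. *)
Definition edges : {set {set X}} :=
  [set [set p.1; p.2] | p in [set p : X * X | e p.1 p.2]].

Definition connected : Prop := forall x y : X, connect e x y.

Definition walk_of_length (x y : X) (k : nat) : bool :=
  [exists p : k.-tuple X, path e x p && (last x p == y)].

Lemma connected_walk (conn : connected) (x y : X) :
  exists k, walk_of_length x y k.
Proof.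
have /connectP[p ep ->] := conn x y.
by exists (size p); apply/existsP; exists (in_tuple p); rewrite ep eqxx.
Qed.

Definition path_metric (conn : connected) (x y : X) : nat :=
  ex_minn (connected_walk conn x y).

End Graph.

Section Laplacian.
Variables (R : realType) (X : finType) (e : rel X).

Definition stationary (x : X) : R := (degree e x)%:R / (2 * #|edges e|%:R).

Definition integral_mu (f : X -> R) : R := \sum_x f x * stationary x.

(* [R^o] is [R] seen as a vector space over itself, so that the real-valued
   functions on [X] form a finite-dimensional vector space over [R]. *)
Definition laplacian_fun (f : {ffun X -> R^o}) : {ffun X -> R^o} :=
  [ffun x => 2 * (f x - (degree e x)%:R^-1 * \sum_(y | e x y) f y)].

Fact laplacian_fun_is_linear : linear laplacian_fun.
Proof.
move=> a f g; apply/ffunP => x; rewrite !ffunE.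
under eq_bigr do rewrite !ffunE.
rewrite big_split -scaler_sumr /= /GRing.scale /=.
move: (\sum_(_ | _) _) (\sum_(_ | _) _) => s t.
by ring.
Qed.

HB.instance Definition _ := GRing.isLinear.Build R {ffun X -> R^o}
  {ffun X -> R^o} _ laplacian_fun laplacian_fun_is_linear.

Definition laplacian : 'End({ffun X -> R^o}) := linfun laplacian_fun.

(* [lam] lists the non-zero eigenvalues of the Laplacian in non-decreasing
   order, each occurring as often as the dimension of its eigenspace.  This
   determines [lam] uniquely. *)
Definition nonzero_spectrum (lam : seq R) : Prop :=
  sorted <=%R lam /\
  forall a : R, count_mem a lam =
    if a == 0 then 0%N else \dim (passmx.leigenspace laplacian a).

End Laplacian.

Section Euclidean.
Variables (R : realType) (n : nat).

(* The norm that the library puts on matrices is the sup norm, hence these. *)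
Definition dotp (u v : 'rV[R]_n) : R := \sum_i u 0 i * v 0 i.

Definition enorm (u : 'rV[R]_n) : R := Num.sqrt (dotp u u).

Definition L2norm (X : finType) (e : rel X) (T : X -> 'rV[R]_n)
    (theta : 'rV[R]_n) : R :=
  Num.sqrt (integral_mu e (fun x => dotp (T x) theta ^+ 2)).

End Euclidean.

(* Main.v *)
Require Import Defs.
From mathcomp Require Import all_boot all_order all_algebra.
From mathcomp Require Import reals.
From mathcomp Require Import complex ring zify.

(** The constant is [c = sqrt 2].  For [f : X -> R] let [energy f] be the sum
    of [(f x - f y) ^ 2] over ordered pairs of adjacent vertices, so that,
    up to the factor [2|E|], it is the quadratic form of the Laplacian in
    [L_2(mu)] (lemma [green_formula]).  Two dimension counts are combined.

    - Functions on the graph.  By the spectral theorem, at most [k]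
      eigenvalues of the Laplacian, 0 included, are smaller than [lambda_k].
      Hence [k] linear conditions on [f] suffice to ensure
      [lambda_k * (\sum_x d(x) f(x) ^ 2) <= energy f] (lemma [graph_poincare]).

    - Directions in [R^n].  The energy of [f = <T, theta>] is a quadratic form
      in [theta] whose trace is the sum of [|T x - T y| ^ 2] over ordered
      adjacent pairs, which is at most the sum [M] of the degrees.  A
      nonnegative form of trace at most [M] has at most [n / 2] eigenvalues
      above [2 M / n], so half of the dimensions may be cut away to ensure
      [energy <T, theta> <= 2 M / n] (lemma [half_dimension_bound]).

    For [k = floor(n / 2) - 1] the two families impose fewer than [n] linear
    conditions on [theta], so some unit vector satisfies them all; as
    [M <= 2|E|], it has squared [L_2] norm at most [2 / (n lambda_k)].

    Both counts rest on the spectral theorem for real symmetric matrices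
    ([real_spectral]), applied on [X] and on ['I_n].  The Laplacian becomes
    symmetric after conjugation by the square root of the degree. *)

Set Implicit Arguments.
Unset Strict Implicit.
Unset Printing Implicit Defensive.

Import Order.TTheory GRing.Theory Num.Theory.

Local Open Scope ring_scope.

(** * The spectral theorem for real symmetric matrices *)

(** A complex eigenvalue exists, and it is real because the matrix is
    Hermitian over the complex numbers. *)
Lemma symmetric_eigenvalue (R : rcfType) n (A : 'M[R]_n.+1) :
  A^T = A -> exists a, eigenvalue A a.
Proof.
move=> symA; pose f := real_complex R; pose Ac := map_mx f A.
have [z zP] := eigenvalue_closed Ac (ltn0Sn n).
have /eigenvalueP[w wA w0] := zP.
pose q := \sum_i w 0 i * (w 0 i)^*.
have q0 : q != 0.
  apply: contra_neq w0 => q0; apply/rowP => i; rewrite mxE; apply/eqP.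
  have /eqP := psumr_eq0P (fun j _ => mul_conjC_ge0 (w 0 j)) q0 isT (i := i).
  by rewrite mul_conjC_eq0.
have wAE j : \sum_i w 0 i * (A i j)%:C%C = z * w 0 j.
  by have /rowP/(_ j) := wA; rewrite !mxE => <-; apply: eq_bigr => i _; rewrite !mxE.
(* [z * q] is the value at [w] of the Hermitian form of [A], hence real. *)
have zq : z * q = z^* * q.
  transitivity (\sum_j (\sum_i w 0 i * (A i j)%:C%C) * (w 0 j)^*).
    by rewrite mulr_sumr; apply: eq_bigr => j _; rewrite wAE mulrA.
  transitivity (\sum_i w 0 i * (\sum_j w 0 j * (A j i)%:C%C)^*); last first.
    by rewrite mulr_sumr; apply: eq_bigr => i _; rewrite wAE rmorphM /= mulrCA.
  under eq_bigr do rewrite mulr_suml.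
  rewrite exchange_big; apply: eq_bigr => i _ /=.
  rewrite rmorph_sum mulr_sumr; apply: eq_bigr => j _ /=.
  rewrite rmorphM /= -{1}symA mxE -mulrA; congr (_ * _).
  rewrite mulrC; congr (_ * _).
  exact/esym/conjc_real.
have /esym/CrealP zr := mulIf q0 zq.
by exists (complex.Re z); move: zP; rewrite -{1}(RRe_real zr) (eigenvalue_map f).
Qed.

Lemma mulmx_tr_ge0 (R : realDomainType) n (v : 'rV[R]_n) : 0 <= (v *m v^T) 0 0.
Proof.
by rewrite mxE; apply: sumr_ge0 => i _; rewrite mxE -expr2 sqr_ge0.
Qed.

Lemma mulmx_tr_eq0 (R : realDomainType) n (v : 'rV[R]_n) :
  ((v *m v^T) 0 0 == 0) = (v == 0).
Proof.
apply/eqP/eqP => [v0|->]; last by rewrite mul0mx mxE.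
apply/rowP => i; rewrite mxE; apply/eqP.
rewrite mxE in v0; have := psumr_eq0P _ v0 isT (i := i).
by rewrite mxE -expr2 => /(_ _)/eqP; rewrite sqrf_eq0; apply => j _; rewrite mxE -expr2 sqr_ge0.
Qed.

(** Householder reflection: a unit row vector is moved to the first basis
    vector by a symmetric orthogonal matrix. *)
Lemma householder (R : realFieldType) n (v : 'rV[R]_n.+1) :
  v *m v^T = 1%:M ->
  exists H : 'M[R]_n.+1,
    [/\ H^T = H, H *m H = 1%:M & v *m H = delta_mx 0 0].
Proof.
move=> v1; pose u := v - delta_mx 0 0.
have [u0|u0] := eqVneq u 0.
  exists 1%:M; rewrite trmx1 mulmx1 mulmx1; split=> //.
  exact: subr0_eq.
have sE (M : 'M[R]_1) : M = (M 0 0)%:M by exact: mx11_scalar.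
set q := (u *m u^T) 0 0; have q0 : q != 0 by rewrite mulmx_tr_eq0.
have uuE : u *m u^T = q%:M by exact: sE.
exists (1%:M - (2 / q) *: (u^T *m u)); split.
- by rewrite linearB /= linearZ /= trmx_mul trmxK trmx1.
- pose U := u^T *m u; have UU : U *m U = q *: U.
    by rewrite /U -mulmxA (mulmxA u) uuE mul_scalar_mx scalemxAr.
  rewrite -/U mulmxBl mul1mx [X in _ - X]mulmxBr mulmx1.
  rewrite -scalemxAl -scalemxAr UU !scalerA opprB addrA -addrA addrC.
  rewrite addrCA -!scalerBl (_ : _ - _ = 0) ?scale0r ?addr0 //.
  by field.
- rewrite mulmxBr mulmx1 -scalemxAr mulmxA (sE (v *m u^T)) mul_scalar_mx.
  rewrite scalerA.
  have e1 : (v *m v^T) 0 0 = 1 by rewrite v1 mxE.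
  have e2 : (v *m (delta_mx 0 0 : 'rV[R]_n.+1)^T) 0 0 = v 0 0.
    by rewrite trmx_delta -colE mxE.
  have e3 : ((delta_mx 0 0 : 'rV[R]_n.+1) *m v^T) 0 0 = v 0 0.
    by rewrite -rowE !mxE.
  have e4 : ((delta_mx 0 0 : 'rV[R]_n.+1) *m (delta_mx 0 0 : 'rV[R]_n.+1)^T) 0 0 = 1 :> R.
    by rewrite trmx_delta mul_delta_mx mxE.
  have vu : (v *m u^T) 0 0 = 1 - v 0 0.
    by rewrite linearB /= mulmxBr mxE e1 mxE e2.
  have qE : q = 2 * (1 - v 0 0).
    have mB (M N : 'M[R]_1) : (M - N) 0 0 = M 0 0 - N 0 0 by rewrite !mxE.
    by rewrite /q linearB /= mulmxBr !mulmxBl !mB e1 e2 e3 e4; ring.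
  have v0 : 1 - v 0 0 != 0 by apply: contra_neq q0 => v0; rewrite qE v0 mulr0.
  have -> : 2 / q * (v *m u^T) 0 0 = 1 by rewrite vu qE; field.
  by rewrite scale1r opprB addrC subrK.
Qed.

(** Orthogonal diagonalisation: the rows of [P] form an orthonormal basis of
    eigenvectors.  A reflection moves a unit eigenvector to the first basis
    vector, which splits off a block of size 1. *)
Theorem real_spectral (R : rcfType) n (A : 'M[R]_n) : A^T = A ->
  exists (P : 'M[R]_n) (d : 'rV[R]_n),
    P *m P^T = 1%:M /\ A = P^T *m diag_mx d *m P.
Proof.
elim: n A => [|n IHn] A symA.
  by exists 1%:M, 0; split; [rewrite trmx1 mulmx1 | apply/matrixP => -[]].
have [a /eigenvalueP[w wA w0]] := symmetric_eigenvalue symA.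
pose s := Num.sqrt ((w *m w^T) 0 0).
have s2 : s ^+ 2 = (w *m w^T) 0 0 by rewrite sqr_sqrtr // mulmx_tr_ge0.
have s0 : s != 0 by rewrite -sqrf_eq0 s2 mulmx_tr_eq0.
pose v := s^-1 *: w.
have v1 : v *m v^T = 1%:M.
  rewrite linearZ /= -scalemxAl -scalemxAr scalerA [w *m _]mx11_scalar -s2.
  by rewrite scale_scalar_mx -invfM -expr2 mulVf // sqrf_eq0.
have vA : v *m A = a *: v by rewrite -scalemxAl wA !scalerA mulrC.
have [H [symH HH vH]] := householder v1.
have [B defB] : exists B : 'M[R]_(1 + n), B = H *m A *m H by exists (H *m A *m H).
have symB : B^T = B by rewrite defB !trmx_mul symH symA mulmxA.
have rowB : row 0 B = a *: delta_mx 0 0.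
  by rewrite defB rowE -vH !mulmxA -(mulmxA v) HH mulmx1 vA -scalemxAl vH.
have urB : ursubmx B = 0.
  apply/rowP => j; have /rowP/(_ (rshift 1 j)) := rowB.
  by rewrite !mxE !mulr0n mulr0 => <-; congr (B _ _); apply: val_inj.
have dlB : dlsubmx B = 0 by rewrite -symB -trmx_ursub urB trmx0.
have ulB : ulsubmx B = a%:M.
  rewrite [ulsubmx B]mx11_scalar; congr _%:M.
  have /rowP/(_ 0) := rowB; rewrite !mxE mulr1 => <-.
  by congr (B _ _); apply: val_inj.
have BE : B = block_mx a%:M 0 0 (drsubmx B) by rewrite -{1}(submxK B) urB dlB ulB.
have [] := IHn (drsubmx B); first by rewrite trmx_drsub symB.
move=> P [d [PP PdP]].
pose Q : 'M[R]_(1 + n) := block_mx 1%:M 0 0 P.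
have QQ : Q *m Q^T = 1%:M.
  rewrite tr_block_mx !trmx0 trmx1 mulmx_block !mulmx0 !mul0mx !addr0 add0r.
  by rewrite mulmx1 PP -scalar_mx_block.
exists (Q *m H), (row_mx a%:M d); split.
  by rewrite trmx_mul symH mulmxA -(mulmxA Q) HH mulmx1 QQ.
rewrite trmx_mul symH -!mulmxA (mulmxA Q^T) (mulmxA (Q^T *m _)).
have -> : Q^T *m diag_mx (row_mx a%:M d) *m Q = B.
  rewrite tr_block_mx !trmx0 trmx1 diag_mx_row !mulmx_block.
  rewrite !mulmx0 !mul0mx !mulmx1 !mul1mx !addr0 !add0r ?mul0mx ?mulmx0 -PdP [RHS]BE.
  by congr block_mx; apply/matrixP => i j; rewrite (ord1 i) (ord1 j) !mxE.
by rewrite defB !mulmxA HH mul1mx -mulmxA HH mulmx1.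
Qed.

(** The same theorem for symmetric kernels on a finite type [X]: [P i] is the
    unit eigenvector of [S] with eigenvalue [d i].  The eigenvectors are
    indexed by [X] itself, which has the right cardinality; the first two
    clauses say that the matrix of [P] is orthogonal on both sides. *)
Definition spectral_decomposition (R : rcfType) (X : finType)
    (S : X -> X -> R) (P : X -> X -> R) (d : X -> R) : Prop :=
  [/\ forall i j, \sum_x P i x * P j x = (i == j)%:R,
      forall x y, \sum_i P i x * P i y = (x == y)%:R &
      forall x y, S x y = \sum_i d i * (P i x * P i y)].

Lemma spectral_decomposition_exists (R : rcfType) (X : finType)
    (S : X -> X -> R) :
  (forall x y, S x y = S y x) ->
  exists P d, spectral_decomposition S P d.
Proof.
move=> symS; pose A := \matrix_(i < #|X|, j < #|X|) S (enum_val i) (enum_val j).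
have [|P [d [PP AE]]] := @real_spectral R _ A.
  by apply/matrixP => i j; rewrite !mxE symS.
exists (fun i x => P (enum_rank i) (enum_rank x)), (fun i => d 0 (enum_rank i)).
have sumE (F : 'I_#|X| -> R) : \sum_x F (enum_rank x) = \sum_i F i.
  rewrite (reindex_onto enum_rank enum_val) /=; last by move=> i _; rewrite enum_valK.
  by apply: eq_bigl => x; rewrite enum_rankK eqxx.
split=> [i j|x y|x y].
- rewrite (sumE (fun k => P (enum_rank i) k * P (enum_rank j) k)).
  have /matrixP/(_ (enum_rank i) (enum_rank j)) := PP.
  rewrite !mxE (inj_eq enum_rank_inj) => <-.
  by apply: eq_bigr => k _; rewrite !mxE.
- rewrite (sumE (fun k => P k (enum_rank x) * P k (enum_rank y))).
  have /matrixP/(_ (enum_rank x) (enum_rank y)) := mulmx1C PP.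
  rewrite !mxE (inj_eq enum_rank_inj) => <-.
  by apply: eq_bigr => k _; rewrite !mxE.
- rewrite (sumE (fun k => d 0 k * (P k (enum_rank x) * P k (enum_rank y)))).
  have /matrixP/(_ (enum_rank x) (enum_rank y)) := AE.
  rewrite mxE !enum_rankK => ->; rewrite -mulmxA mul_diag_mx mxE.
  by apply: eq_bigr => k _; rewrite !mxE mulrCA.
Qed.

Section Decomposition.
Variables (R : rcfType) (X : finType) (S : X -> X -> R).
Variables (P : X -> X -> R) (d : X -> R).
Hypothesis SPd : spectral_decomposition S P d.

Lemma decomposition_eigenvector i x : \sum_y S x y * P i y = d i * P i x.
Proof.
have [PP _ SE] := SPd.
under eq_bigr do rewrite SE mulr_suml.
rewrite exchange_big /=; transitivity (\sum_j d j * P j x * (i == j)%:R).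
  by apply: eq_bigr => j _; rewrite -PP mulr_sumr; apply: eq_bigr => y _; ring.
rewrite (bigD1 i) //= eqxx mulr1 [X in _ + X]big1 ?addr0 // => j ji.
by rewrite eq_sym (negPf ji) mulr0.
Qed.

Let diagonal_form (a : X -> R) (F : X -> R) :
  \sum_x \sum_y (\sum_i a i * (P i x * P i y)) * (F x * F y) =
  \sum_i a i * (\sum_x P i x * F x) ^+ 2.
Proof.
have -> : \sum_x \sum_y (\sum_i a i * (P i x * P i y)) * (F x * F y) =
   \sum_x \sum_i \sum_y a i * ((P i x * F x) * (P i y * F y)).
  apply: eq_bigr => x _; rewrite exchange_big; apply: eq_bigr => y _ /=.
  by rewrite mulr_suml; apply: eq_bigr => i _; ring.
rewrite exchange_big; apply: eq_bigr => i _ /=.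
rewrite expr2 mulr_suml mulr_sumr; apply: eq_bigr => x _.
by rewrite !mulr_sumr.
Qed.

Lemma decomposition_form (F : X -> R) :
  \sum_x \sum_y S x y * (F x * F y) = \sum_i d i * (\sum_x P i x * F x) ^+ 2.
Proof.
have [_ _ SE] := SPd; rewrite -diagonal_form.
by apply: eq_bigr => x _; apply: eq_bigr => y _; rewrite SE.
Qed.

Lemma decomposition_parseval (F : X -> R) :
  \sum_x F x ^+ 2 = \sum_i (\sum_x P i x * F x) ^+ 2.
Proof.
have [_ PP _] := SPd.
have -> : \sum_i (\sum_x P i x * F x) ^+ 2 =
    \sum_i 1 * (\sum_x P i x * F x) ^+ 2 by apply: eq_bigr => i _; rewrite mul1r.
rewrite -diagonal_form; apply: eq_bigr => x _.
under eq_bigr => y _ do under eq_bigr do rewrite mul1r.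
rewrite (bigD1 x) //= PP eqxx mul1r -expr2 [X in _ + X]big1 ?addr0 // => y yx.
by rewrite PP eq_sym (negPf yx) mul0r.
Qed.

Lemma decomposition_trace : \sum_x S x x = \sum_i d i.
Proof.
have [PP _ SE] := SPd; under eq_bigr do rewrite SE.
rewrite exchange_big; apply: eq_bigr => i _ /=.
by rewrite -mulr_sumr PP eqxx mulr1.
Qed.

End Decomposition.

(** * Quadratic forms and orthogonality in Euclidean space *)

Lemma exists_orthogonal (R : realType) n (L : seq 'rV[R]_n) :
  (size L < n)%N ->
  exists2 w : 'rV[R]_n, w != 0 & forall v, v \in L -> dotp v w = 0.
Proof.
move=> ltLn; pose M := \matrix_(j < n, i < size L) L`_i 0 j.
have /rowV0Pn[w /sub_kermxP wM w0] : kermx M != 0.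
  rewrite -mxrank_eq0 mxrank_ker subn_eq0 -ltnNge.
  exact: leq_ltn_trans (rank_leq_col M) ltLn.
exists w => // v vL; have iL : (index v L < size L)%N by rewrite index_mem.
have /rowP/(_ (Ordinal iL)) := wM; rewrite !mxE => wv; rewrite -[RHS]wv.
by apply: eq_bigr => j _; rewrite mxE /= nth_index // mulrC.
Qed.

Section Dotp.
Variables (R : realType) (n : nat).
Implicit Types u v w : 'rV[R]_n.

Lemma dotpZl a u v : dotp (a *: u) v = a * dotp u v.
Proof. by rewrite /dotp mulr_sumr; apply: eq_bigr => i _; rewrite mxE mulrA. Qed.

Lemma dotpZr a u v : dotp u (a *: v) = a * dotp u v.
Proof. by rewrite /dotp mulr_sumr; apply: eq_bigr => i _; rewrite mxE mulrCA. Qed.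

Lemma dotpBl u v w : dotp (u - v) w = dotp u w - dotp v w.
Proof.
by rewrite /dotp -sumrB; apply: eq_bigr => i _; rewrite !mxE mulrBl.
Qed.

Lemma dotp_suml (I : finType) (a : I -> R) (V : I -> 'rV[R]_n) w :
  dotp (\sum_i a i *: V i) w = \sum_i a i * dotp (V i) w.
Proof.
rewrite /dotp; under [RHS]eq_bigr do rewrite mulr_sumr.
rewrite exchange_big; apply: eq_bigr => j _ /=.
by rewrite summxE mulr_suml; apply: eq_bigr => i _; rewrite mxE mulrA.
Qed.

Lemma dotp_gt0 u : u != 0 -> 0 < dotp u u.
Proof.
move=> u0; have E : dotp u u = (u *m u^T) 0 0.
  by rewrite mxE; apply: eq_bigr => i _; rewrite mxE.
by rewrite E lt_def mulmx_tr_ge0 mulmx_tr_eq0 u0.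
Qed.

Lemma dotp_ge0 u : 0 <= dotp u u.
Proof. by apply: sumr_ge0 => i _; rewrite -expr2 sqr_ge0. Qed.

End Dotp.

(** A form [w |-> \sum_i <V i, w> ^ 2] of trace [M] is at most
    [(2 M / n) |w| ^ 2] on a subspace of codimension at most [n / 2], namely
    on the orthogonal complement of the eigenvectors in [L], those with
    eigenvalue above [2 M / n].  The inequality is multiplied by [n], so that
    [n = 0] needs no exception. *)
Lemma half_dimension_bound (R : realType) n (I : finType) (Q : pred I)
    (V : I -> 'rV[R]_n) :
  exists L : seq 'rV[R]_n, (2 * size L <= n)%N /\
    forall w, (forall v, v \in L -> dotp v w = 0) ->
      n%:R * \sum_(i | Q i) dotp (V i) w ^+ 2 <=
      2 * (\sum_(i | Q i) dotp (V i) (V i)) * dotp w w.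
Proof.
pose S (a b : 'I_n) := \sum_(i | Q i) V i 0 a * V i 0 b.
have [|P [g SPg]] := @spectral_decomposition_exists R _ S.
  by move=> a b; apply: eq_bigr => i _; rewrite mulrC.
have SE (F : 'I_n -> R) : \sum_a \sum_b S a b * (F a * F b) =
    \sum_(i | Q i) (\sum_a V i 0 a * F a) ^+ 2.
  under [RHS]eq_bigr do rewrite expr2 mulr_suml.
  rewrite [RHS]exchange_big; apply: eq_bigr => a _ /=.
  under [RHS]eq_bigr do rewrite mulr_sumr.
  rewrite [RHS]exchange_big; apply: eq_bigr => b _ /=.
  by rewrite mulr_suml; apply: eq_bigr => i _; ring.
have g_ge0 j : 0 <= g j.
  have -> : g j = \sum_a \sum_b S a b * (P j a * P j b).
    have [PP _ _] := SPg; under eq_bigr => a _.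
      under eq_bigr do rewrite mulrCA.
      rewrite -mulr_sumr (decomposition_eigenvector SPg) mulrCA; over.
    by rewrite -mulr_sumr PP eqxx mulr1.
  by rewrite SE; apply: sumr_ge0 => i _; rewrite sqr_ge0.
set M := \sum_(i | Q i) dotp (V i) (V i).
have M_ge0 : 0 <= M by apply: sumr_ge0 => i _; exact: dotp_ge0.
have gM : \sum_j g j = M.
  by rewrite -(decomposition_trace SPg) /S exchange_big.
pose bad := [pred j | 2 * M < n%:R * g j].
exists [seq \row_a P j a | j <- enum bad]; split.
  rewrite size_map -cardE; case: (pickP bad) => [j0 bad0|/eq_card0->//].
  have M_gt0 : 0 < M.
    rewrite lt_def M_ge0 andbT; apply: contraTneq bad0 => M0.
    have g0 := psumr_eq0P (fun j _ => g_ge0 j) (etrans gM M0).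
    by rewrite !inE M0 (g0 j0) // !mulr0 ltxx.
  (* Markov's inequality for the eigenvalues. *)
  have badM : \sum_(j in bad) 2 * M <= n%:R * M.
    rewrite -[X in _ <= _ * X]gM [leRHS]mulr_sumr [leRHS](bigID (mem bad)) -[leLHS]addr0.
    apply: lerD; first by apply: ler_sum => j /ltW.
    by apply: sumr_ge0 => j _; rewrite mulr_ge0.
  rewrite -(ler_nat R) -(ler_pM2r M_gt0) natrM; apply: le_trans badM.
  by rewrite sumr_const -[leRHS]mulr_natl mulrA [_%:R * 2]mulrC.
move=> w wL.
have wE : \sum_(i | Q i) dotp (V i) w ^+ 2 =
    \sum_j g j * (\sum_a P j a * w 0 a) ^+ 2.
  by rewrite -(decomposition_form SPg) SE.
have wwE : dotp w w = \sum_j (\sum_a P j a * w 0 a) ^+ 2.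
  by rewrite -(decomposition_parseval SPg); apply: eq_bigr => a _; rewrite expr2.
rewrite wE wwE [leLHS]mulr_sumr [leRHS]mulr_sumr; apply: ler_sum => j _.
have [bj|nbj] := boolP (bad j).
  have -> : \sum_a P j a * w 0 a = 0.
    rewrite -[RHS](wL (\row_a P j a)); last by apply/map_f; rewrite mem_enum.
    by apply: eq_bigr => a _; rewrite mxE.
  by rewrite expr0n !mulr0.
by rewrite mulrA ler_wpM2r ?sqr_ge0 // leNgt.
Qed.
(** * Degrees, edges and the path metric *)

(** The map from ordered adjacent pairs to edges is at most two-to-one. *)
Lemma sum_degree_le (X : finType) (e : rel X) :
  (\sum_x degree e x <= 2 * #|edges e|)%N.
Proof.
pose D := [set p : X * X | e p.1 p.2].
have -> : (\sum_x degree e x = #|D|)%N.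
  rewrite -sum1_card.
  rewrite [RHS](eq_bigl (fun p : X * X => e p.1 p.2)) => [|p]; last by rewrite inE.
  rewrite -(pair_big_dep xpredT (fun x y => e x y) (fun _ _ => 1%N)) /=.
  by apply: eq_bigr => x _; rewrite /degree -sum1_card; apply: eq_bigl => y; rewrite inE.
rewrite -sum1_card (partition_big_imset (fun p : X * X => [set p.1; p.2])) /=.
rewrite mulnC -sum_nat_const; apply: leq_sum => A /imsetP[[a b] _ ->] /=.
rewrite sum1_card -(leq_add2r 0) addn0.
have /subset_leq_card/leq_trans : [pred p in D | [set p.1; p.2] == [set a; b]]
    \subset [:: (a, b); (b, a)].
  apply/subsetP => -[x y]; rewrite !inE => /andP[_ /eqP/setP xy] /=.
  have := xy x; have := xy y; have := xy a; have := xy b.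
  rewrite !inE !eqxx !orbT /= !xpair_eqE !(eq_sym a) !(eq_sym b).
  by do 4!case: eqP => //=.
by apply; exact: card_size.
Qed.

Lemma degree_gt0 (X : finType) (e : rel X) (x : X) :
  connected e -> (1 < #|X|)%N -> (0 < degree e x)%N.
Proof.
move=> conn; rewrite (cardD1 x) ltnS => /card_gt0P[y]; rewrite !inE andbT => yx.
have /connectP[[|z p] /=] := conn x y; first by move=> _ /eqP; rewrite (negPf yx).
by move=> /andP[exz _] _; apply/card_gt0P; exists z; rewrite inE.
Qed.

Lemma path_metric_edge (X : finType) (e : rel X) (conn : connected e) x y :
  e x y -> (path_metric conn x y <= 1)%N.
Proof.
move=> exy; rewrite /path_metric; case: ex_minnP => k _; apply.
by apply/existsP; exists [tuple y]; rewrite /= exy eqxx.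
Qed.

(** * The Laplacian and its eigenfunctions *)

Section GraphLaplacian.
Variables (R : realType) (X : finType) (e : rel X).
Hypotheses (e_sym : symmetric e) (deg_gt0 : forall x, (0 < degree e x)%N).

(** Every undirected edge is counted twice, once for each order of its
    endpoints. *)
Definition energy (f : X -> R) : R := \sum_x \sum_(y | e x y) (f x - f y) ^+ 2.

Local Notation deg x := ((degree e x)%:R : R).
Local Notation sdeg x := (Num.sqrt (degree e x)%:R : R).

Let sdeg_gt0 x : 0 < sdeg x. Proof. by rewrite sqrtr_gt0 ltr0n. Qed.

Let sdeg_neq0 x : sdeg x != 0. Proof. by rewrite gt_eqF. Qed.

Let sdegK x : sdeg x ^+ 2 = deg x. Proof. by rewrite sqr_sqrtr. Qed.

Let deg_neq0 x : deg x != 0. Proof. by rewrite pnatr_eq0 -lt0n. Qed.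

Lemma green_formula (f : {ffun X -> R^o}) :
  \sum_x deg x * (f x * laplacian_fun e f x) = energy f.
Proof.
have sumC (a : R) x : \sum_(y | e x y) a = deg x * a.
  by rewrite sumr_const mulr_natl; congr (_ *+ _); apply: eq_card => y; rewrite !inE.
have diag : \sum_x \sum_(y | e x y) f y ^+ 2 = \sum_x deg x * f x ^+ 2.
  rewrite (exchange_big_dep xpredT) //=; apply: eq_bigr => y _.
  by rewrite -sumC; apply: eq_bigl => x; rewrite e_sym.
transitivity (\sum_x deg x * f x ^+ 2 + \sum_x deg x * f x ^+ 2
    - 2 * \sum_x \sum_(y | e x y) f x * f y).
  rewrite mulr_sumr -big_split -sumrB; apply: eq_bigr => x _ /=.
  by rewrite ffunE -mulr_sumr; field.
rewrite -{2}diag mulr_sumr -big_split -sumrB; apply: eq_bigr => x _ /=.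
rewrite -sumC mulr_sumr -big_split -sumrB; apply: eq_bigr => y _ /=.
by ring.
Qed.

(** The kernel of the symmetric operator [D^(1/2) Delta D^(-1/2)], where [D]
    is the diagonal matrix of degrees. *)
Definition sym_laplacian (x y : X) : R :=
  2 * ((x == y)%:R - (e x y)%:R / (sdeg x * sdeg y)).

Lemma sym_laplacian_sym x y : sym_laplacian x y = sym_laplacian y x.
Proof. by rewrite /sym_laplacian eq_sym e_sym [_ * sdeg y]mulrC. Qed.

Lemma sym_laplacianE (f : {ffun X -> R^o}) x :
  \sum_y sym_laplacian x y * (sdeg y * f y) = sdeg x * laplacian_fun e f x.
Proof.
have E y : sym_laplacian x y * (sdeg y * f y) =
    2 * ((x == y)%:R * (sdeg y * f y)) - 2 / sdeg x * ((e x y)%:R * f y).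
  by rewrite /sym_laplacian; field; rewrite !sdeg_neq0.
under eq_bigr do rewrite E.
rewrite sumrB -!mulr_sumr.
have -> : \sum_y (x == y)%:R * (sdeg y * f y) = sdeg x * f x.
  rewrite (bigD1 x) //= eqxx mul1r big1 ?addr0 // => y yx.
  by rewrite eq_sym (negPf yx) mul0r.
have -> : \sum_y (e x y)%:R * f y = \sum_(y | e x y) f y.
  by rewrite [RHS]big_mkcond; apply: eq_bigr => y _; case: (e x y); rewrite (mul1r, mul0r).
rewrite ffunE; move: (sdeg_neq0 x) (sdegK x); move: (sdeg x) => s s0 <-.
by field.
Qed.

Variables (P : X -> X -> R) (d : X -> R).
Hypothesis SPd : spectral_decomposition sym_laplacian P d.

(** Eigenvectors of the symmetrised operator, carried back to eigenfunctions
    of the Laplacian. *)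
Definition eigenfunction (i : X) : {ffun X -> R^o} := [ffun x => P i x / sdeg x].

Let eigenfunctionK i x : sdeg x * eigenfunction i x = P i x.
Proof. by rewrite ffunE mulrC divfK. Qed.

Lemma laplacian_eigenfunction i :
  laplacian R e (eigenfunction i) = d i *: eigenfunction i.
Proof.
rewrite lfunE /=; apply/ffunP => x; apply: (mulfI (sdeg_neq0 x)).
rewrite -sym_laplacianE [in RHS]ffunE [_ *: _]/(_ * _) mulrCA eigenfunctionK.
rewrite -(decomposition_eigenvector SPd).
by apply: eq_bigr => y _; rewrite eigenfunctionK.
Qed.

Lemma energy_decomposition (f : {ffun X -> R^o}) :
  energy f = \sum_i d i * (\sum_x P i x * (sdeg x * f x)) ^+ 2.
Proof.
rewrite -(decomposition_form SPd) -green_formula; apply: eq_bigr => x _.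
under [RHS]eq_bigr do rewrite mulrCA.
by rewrite -[in LHS]sdegK -mulr_sumr sym_laplacianE; ring.
Qed.

(** The eigenfunctions with eigenvalue [a] are linearly independent elements
    of the eigenspace. *)
Lemma eigenfunction_multiplicity (a : R) :
  (#|[pred i | d i == a]| <= \dim (passmx.leigenspace (laplacian R e) a))%N.
Proof.
have [PP _ _] := SPd.
pose s := enum [pred i | d i == a].
pose W := [seq eigenfunction i | i <- s].
have freeW : free W.
  have sW : size W = size s by rewrite size_map.
  apply/(@freeP _ _ _ (in_tuple W)) => k kW j.
  have js : (j < size s)%N by rewrite -sW.
  pose i0 := tnth (in_tuple s) (Ordinal js).
  have nthW (l : 'I_(size W)) x : sdeg x * W`_l x = P (nth i0 s l) x.
    by rewrite (nth_map i0) ?eigenfunctionK // -sW.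
  have : \sum_x P (nth i0 s j) x * (sdeg x * (\sum_(l < size W) k l *: W`_l) x) = 0.
    by rewrite kW big1 // => x _; rewrite ffunE !mulr0.
  have -> : \sum_x P (nth i0 s j) x * (sdeg x * (\sum_(l < size W) k l *: W`_l) x) =
     \sum_(l < size W) k l * \sum_x P (nth i0 s j) x * P (nth i0 s l) x.
    under [RHS]eq_bigr do rewrite mulr_sumr.
    rewrite exchange_big; apply: eq_bigr => x _ /=.
    rewrite sum_ffunE !mulr_sumr; apply: eq_bigr => l _.
    by rewrite ffunE -(nthW l) /GRing.scale /=; ring.
  rewrite (bigD1 j) //= PP eqxx mulr1 big1 ?addr0 // => l lj.
  rewrite PP nth_uniq -?sW ?enum_uniq //.
  by rewrite [_ == _](_ : _ = false) ?mulr0 // eq_sym; apply: negPf.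
have subW i : i \in s -> eigenfunction i \in passmx.leigenspace (laplacian R e) a.
  rewrite mem_enum inE => /eqP dia.
  rewrite memv_ker add_lfunE opp_lfunE scale_lfunE id_lfunE.
  by rewrite laplacian_eigenfunction dia subrr.
rewrite cardE -/s -(size_map eigenfunction) -(eqP freeW); apply/dimvS/span_subvP.
by apply/allP; rewrite all_map; apply/allP.
Qed.

(** An eigenfunction with eigenvalue 0 has no energy, so it is constant on a
    connected graph; two constants cannot be orthogonal. *)
Lemma kernel_multiplicity : connected e -> (#|[pred i | d i == 0%R]| <= 1)%N.
Proof.
move=> conn; have [PP _ _] := SPd; rewrite leqNgt; apply/negP.
case/card_gt1P => i [j [/eqP di /eqP dj ij]].
have const l : d l = 0 -> forall x y, eigenfunction l x = eigenfunction l y.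
  move=> dl; have : energy (eigenfunction l) = 0.
    rewrite -green_formula big1 // => x _.
    have /ffunP/(_ x) := laplacian_eigenfunction l.
    by rewrite lfunE /= => ->; rewrite dl scale0r [X in _ * (_ * X)]ffunE !mulr0.
  move=> E0 x y; have /connectP[p] := conn x y.
  elim: p x => [|z p IHp] x /=; first by move=> _ ->.
  case/andP=> exz /IHp /[apply] <-; apply/eqP; rewrite -subr_eq0 -sqrf_eq0; apply/eqP.
  have Ex := psumr_eq0P _ E0 (i := x).
  apply: (psumr_eq0P _ (Ex _ isT)) exz => [y' _|x' _]; rewrite ?sqr_ge0 //.
  by apply: sumr_ge0 => y' _; rewrite sqr_ge0.
pose c l := eigenfunction l i.
have PE l x : d l = 0 -> P l x = c l * sdeg x.
  by move=> dl; rewrite -eigenfunctionK mulrC (const l dl x i).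
have cN0 l : d l = 0 -> c l != 0.
  move=> dl; apply/eqP => cl0; have := PP l l; rewrite big1 => [/eqP|x _].
    by rewrite eqxx eq_sym oner_eq0.
  by rewrite PE // cl0 !mul0r.
suff : \sum_x P i x * P j x != 0 by rewrite PP (negPf ij) eqxx.
under eq_bigr do rewrite (PE i) // (PE j) // mulrACA -expr2 sdegK.
rewrite -mulr_sumr !mulf_neq0 ?cN0 // -natr_sum pnatr_eq0 -lt0n.
by rewrite (bigD1 i) //= addn_gt0 deg_gt0.
Qed.

End GraphLaplacian.

(** * The Poincare inequality on a subspace of codimension k *)

(** Under the at most [k] conditions given by [L], the energy is bounded below by
    [lambda_k].  The positivity of [lambda_k] includes the fact that the
    spectrum has at least [k] entries, so that [lam`_k.-1] is not the default
    value of [nth]. *)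
Lemma graph_poincare (R : realType) (X : finType) (e : rel X) (lam : seq R)
    (k : nat) :
  symmetric e -> connected e -> (1 < #|X|)%N -> nonzero_spectrum e lam ->
  (1 <= k <= #|X| - 1)%N ->
  0 < lam`_k.-1 /\
  exists L : seq {ffun X -> R^o}, (size L <= k)%N /\
    forall f : X -> R, (forall h, h \in L -> \sum_x h x * f x = 0) ->
      lam`_k.-1 * \sum_x (degree e x)%:R * f x ^+ 2 <= energy e f.
Proof.
move=> e_sym conn X_gt1 [lam_sorted lamP] /andP[k_gt0 k_le].
have deg_gt0 x : (0 < degree e x)%N by exact: degree_gt0.
have [P [d SPd]] := spectral_decomposition_exists (sym_laplacian_sym R e_sym).
have ker1 := kernel_multiplicity e_sym deg_gt0 SPd conn.
(* Up to order, the nonzero [d i] form a subsequence of [lam]. *)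
pose s := [seq d i | i <- enum [pred i | d i != 0]].
have [s' s'lam ss'] : exists2 s', subseq s' lam & perm_eq s s'.
  apply/count_subseqP => a; rewrite lamP; case: eqP => [->|/eqP a0].
    rewrite leqn0; apply/eqP/count_memPn/mapP => -[x]; rewrite mem_enum inE.
    by move=> /eqP dx0 /esym.
  apply: leq_trans (eigenfunction_multiplicity deg_gt0 SPd a).
  rewrite count_map -size_filter cardE; apply: uniq_leq_size.
    by rewrite filter_uniq ?enum_uniq.
  by move=> i; rewrite mem_filter !mem_enum => /andP[].
have k_lam : (k.-1 < size lam)%N.
  rewrite prednK //; apply: leq_trans (size_subseq s'lam).
  rewrite -(perm_size ss') size_map -cardE.
  apply: leq_trans k_le _; rewrite leq_subLR -(cardC [pred i | d i == 0]).
  by rewrite leq_add2r.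
set l := lam`_k.-1.
split.
  have : l \in lam by exact: mem_nth.
  rewrite -has_pred1 has_count lamP; case: eqP => // /eqP l0.
  rewrite lt0n dimv_eq0 => /eqP; set E := passmx.leigenspace _ _ => E0.
  have fE := memv_pick E; have f0 : vpick E != 0 by rewrite vpick0; apply/eqP.
  move: (vpick E) fE f0 => f.
  rewrite memv_ker add_lfunE opp_lfunE scale_lfunE id_lfunE subr_eq0 lfunE /=.
  move=> /eqP fl f0.
  have := green_formula e_sym deg_gt0 f; rewrite fl => fE.
  have {}fE : l * \sum_x (degree e x)%:R * f x ^+ 2 = energy e f.
    rewrite -fE mulr_sumr; apply: eq_bigr => x _.
    by rewrite ffunE /GRing.scale /=; ring.
  have norm_ge0 : 0 <= \sum_x (degree e x)%:R * f x ^+ 2.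
    by apply: sumr_ge0 => x _; rewrite mulr_ge0 ?sqr_ge0.
  have norm_gt0 : 0 < \sum_x (degree e x)%:R * f x ^+ 2.
    rewrite lt_def norm_ge0 andbT; apply: contra_neq f0 => n0.
    apply/ffunP => x; rewrite ffunE; apply/eqP.
    have /eqP := psumr_eq0P (fun x _ => mulr_ge0 (ler0n R _) (sqr_ge0 _)) n0 isT (i := x).
    by rewrite mulf_eq0 pnatr_eq0 eqn0Ngt deg_gt0 sqrf_eq0.
  rewrite lt_def l0 /= -(pmulr_lge0 _ norm_gt0) fE.
  by apply: sumr_ge0 => x _; apply: sumr_ge0 => y _; rewrite sqr_ge0.
(* One eigenvalue 0, and at most [k.-1] entries of [lam] below [lambda_k]. *)
have lowk : (#|[pred i | (d i < l)%R]| <= k)%N.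
  have count_lt : (count (< l)%R lam <= k.-1)%N.
    rewrite leqNgt; apply/negP => /(nth_count_lt 0 lam_sorted).
    by rewrite ltxx.
  have s_lt : (count (< l)%R s <= k.-1)%N.
    have /permP -> := ss'.
    exact: leq_trans (leq_count_subseq _ s'lam) count_lt.
  rewrite -(prednK k_gt0) -addn1 addnC.
  apply: leq_trans (leq_add ker1 s_lt).
  rewrite count_map -size_filter -(cardID [pred i | d i == 0]).
  apply: leq_add.
    by apply: subset_leq_card; apply/subsetP => i; rewrite !inE => /andP[].
  rewrite cardE; apply: uniq_leq_size; first exact: enum_uniq.
  by move=> i; rewrite mem_enum [in X in _ -> X]mem_filter mem_enum !inE andbC.
pose h i : {ffun X -> R^o} := [ffun x => P i x * Num.sqrt (degree e x)%:R].
exists [seq h i | i <- enum [pred i | d i < l]]; split.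
  by rewrite size_map -cardE.
move=> f fL; pose f' : {ffun X -> R^o} := finfun f.
have -> : energy e f = energy e f'.
  by apply: eq_bigr => x _; apply: eq_bigr => y _; rewrite !ffunE.
rewrite (energy_decomposition e_sym deg_gt0 SPd).
have -> : \sum_x (degree e x)%:R * f x ^+ 2 =
    \sum_x (Num.sqrt (degree e x)%:R * f' x) ^+ 2.
  by apply: eq_bigr => x _; rewrite ffunE exprMn sqr_sqrtr.
rewrite (decomposition_parseval SPd) mulr_sumr; apply: ler_sum => i _.
have [dil|ldi] := ltP (d i) l; last by rewrite ler_wpM2r ?sqr_ge0.
have -> : \sum_x P i x * (Num.sqrt (degree e x)%:R * f' x) = 0.
  rewrite -[RHS](fL (h i)); last by apply/map_f; rewrite mem_enum.
  by apply: eq_bigr => x _; rewrite !ffunE mulrA.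
by rewrite expr0n !mulr0.
Qed.

(** * Directions of small norm *)

(* [lam] is indexed from 0, so [lam`_k.-1] is lambda_k. *)
Theorem theorem1p2 (R : realType) :
  exists c : R, 0 < c /\
  forall (X : finType) (e : rel X) (e_sym : symmetric e)
    (e_irr : irreflexive e) (conn : connected e) (X_gt1 : (1 < #|X|)%N)
    (lam : seq R) (lamP : nonzero_spectrum e lam)
    (n : nat) (n_gt1 : (1 < n)%N)
    (k : nat) (kE : k = (n./2 - 1)%N) (k_range : (1 <= k <= #|X| - 1)%N)
    (T : X -> 'rV[R]_n)
    (T_lip : forall x y : X, enorm (T x - T y) <= (path_metric conn x y)%:R),
  exists theta : 'rV[R]_n, enorm theta = 1 /\
    L2norm e T theta <= c * (Num.sqrt n%:R)^-1 * (Num.sqrt lam`_k.-1)^-1.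
Proof.
exists (Num.sqrt 2); split=> [|X e e_sym _ conn X_gt1 lam lamP n n_gt1 k kE k_range T T_lip].
  by rewrite sqrtr_gt0.
have [l_gt0 [L1 [sizeL1 L1P]]] := graph_poincare e_sym conn X_gt1 lamP k_range.
have [L2 [sizeL2 L2P]] := half_dimension_bound
  (fun p : X * X => e p.1 p.2) (fun p => T p.1 - T p.2).
pose L := L2 ++ [seq \sum_x h x *: T x | h : {ffun X -> R^o} <- L1].
have sizeL : (size L < n)%N.
  rewrite size_cat size_map; have := odd_double_half n.
  rewrite -mul2n; move: kE k_range sizeL1 sizeL2; move: (n./2) (odd n) => m b.
  move=> -> /andP[]; lia.
have [w w0 wL] := exists_orthogonal sizeL.
(* The conditions are homogeneous, so [w] may be normalised. *)
pose theta := (enorm w)^-1 *: w.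
have w_gt0 : 0 < enorm w by rewrite sqrtr_gt0 dotp_gt0.
have theta1 : dotp theta theta = 1.
  rewrite dotpZl dotpZr -[dotp w w]sqr_sqrtr ?dotp_ge0 // -/(enorm w).
  by field; rewrite gt_eqF.
have thetaL v : v \in L -> dotp v theta = 0.
  by move=> vL; rewrite dotpZr wL // mulr0.
exists theta; split; first by rewrite /enorm theta1 sqrtr1.
pose f x := dotp (T x) theta.
set E := (#|edges e|)%:R : R.
set M := \sum_x (degree e x)%:R : R.
have M_gt0 : 0 < M.
  have [x _] : exists x : X, x \in X by apply/card_gt0P; exact: ltnW.
  rewrite /M -natr_sum ltr0n (bigD1 x) //= addn_gt0.
  by rewrite degree_gt0.
have M_le : M <= 2 * E by rewrite /M /E -natr_sum -natrM ler_nat sum_degree_le.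
have n_gt0 : 0 < n%:R :> R by rewrite ltr0n ltnW.
have energy_le : n%:R * energy e f <= 2 * M.
  have -> : energy e f =
      \sum_(p : X * X | e p.1 p.2) dotp (T p.1 - T p.2) theta ^+ 2.
    rewrite -(pair_big_dep xpredT (fun x y => e x y)
      (fun x y => dotp (T x - T y) theta ^+ 2)) /=.
    by apply: eq_bigr => x _; apply: eq_bigr => y _; rewrite dotpBl.
  apply: (le_trans (L2P _ _)) => [v vL2|].
    by apply: thetaL; rewrite mem_cat vL2.
  (* By the Lipschitz condition each ordered adjacent pair contributes at most 1. *)
  rewrite theta1 mulr1 ler_pM2l //.
  rewrite -(pair_big_dep xpredT (fun x y => e x y)
      (fun x y => dotp (T x - T y) (T x - T y))) /=.
  apply: ler_sum => x _; rewrite /degree -sum1_card natr_sum.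
  rewrite [leRHS](eq_bigl (e x)) => [|y]; last by rewrite inE.
  apply: ler_sum => y exy.
  rewrite -[leLHS]sqr_sqrtr ?dotp_ge0 // -/(enorm _) expr_le1 ?sqrtr_ge0 //.
  by apply: le_trans (T_lip x y) _; rewrite lern1 (path_metric_edge conn exy).
have low : lam`_k.-1 * \sum_x (degree e x)%:R * f x ^+ 2 <= energy e f.
  apply: L1P => h hL1; rewrite -dotp_suml thetaL // mem_cat.
  by rewrite (map_f (fun h : {ffun X -> R^o} => \sum_x h x *: T x)) ?orbT.
have E2_gt0 : 0 < 2 * E by apply: lt_le_trans M_le.
set N := \sum_x _ in low.
have -> : L2norm e T theta = Num.sqrt (N / (2 * E)).
  congr Num.sqrt; rewrite mulr_suml; apply: eq_bigr => x _.
  by rewrite /stationary mulrA [_ ^+ 2 * _]mulrC.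
rewrite -sqrtrV ?ler0n // -sqrtrV ?(ltW l_gt0) // -!sqrtrM ?mulr_ge0 ?invr_ge0 ?ler0n //.
rewrite ler_wsqrtr // ler_pdivrMr // mulrAC ler_pdivlMr // mulrAC ler_pdivlMr //.
rewrite mulrC [N * _]mulrC.
apply: le_trans (ler_wpM2l (ltW n_gt0) low) (le_trans energy_le _).
by rewrite ler_pM2l.
Qed.
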